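(* Consider the market with listed option prices described in the context. Let $\xi>0$ and let $p,q>1$ satisfy $\frac1p+\frac1q=1$ and $\tilde\xi p>1$, where $\tilde\xi=\frac{2\xi}{\tau}$. Let $t<T$ and let $\Pi^1_t,\Pi^2_t,\Pi^3_t$ be the time-$t$ values of the option portfolios defined in the context. If the inequality $\Pi_t^3<\Pi_t^1+\Pi_t^2$ is reversed at time $t$, that is, if $\Pi_t^3>\Pi_t^1+\Pi_t^2$, then there is an arbitrage at time $t$.
   Context: Market: $S_t>0$ is the price of an underlying asset, $r\ge0$ a constant interest rate, $B_{t,T}=e^{-r(T-t)}$ the price at $t$ of the bond paying $1$ at $T$, and $F_{t,T}=S_t/B_{t,T}$ the futures price on $S_T$. $\tau>0$ is a constant (30 days), $T>0$ is fixed. Listed at each time are prices $P(t,K,T')$ and $C(t,K,T')$ of European puts and calls on $S_{T'}$ (payoffs $(K-S_{T'})^+$, $(S_{T'}-K)^+$ at $T'$) for all strikes $K>0$, and prices $C^{vix}(t,K,T)$ of European calls on $\mathrm{VIX}_T$ (payoff $(\mathrm{VIX}_T-K)^+$ at $T$). These listed prices are not assumed to be given by risk-neutral expectations (options may be mispriced). Prices at maturity equal payoffs. Static portfolios holding a continuum of options over strikes (together with bonds, futures and the underlying) are allowed; the cost of such a portfolio is the corresponding integral of listed prices, and all integrals below (at times $t$ and $T$) are assumed finite. The VIX is computed from listed prices: $$\mathrm{VIX}_T^2=\frac{2}{\tau B_{T,T+\tau}}\left(\int_0^{F_{T,T+\tau}}P(T,K,T+\tau)\frac{dK}{K^2}+\int_{F_{T,T+\tau}}^\infty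 C(T,K,T+\tau)\frac{dK}{K^2}\right),$$ i.e. $\mathrm{VIX}_T^2$ is the future (undiscounted) value at time $T$ of the replicated claim $-\frac2\tau\log(S_{T+\tau}/F_{T,T+\tau})$ paid at $T+\tau$. Portfolios, for $t\le T$, with $\tilde\xi=2\xi/\tau$: $$\Pi_t^1=\frac{\tilde\xi(\tilde\xi q+1)}{B_{T,T+\tau}}\int_0^\infty\frac{P(t,K,T+\tau)}{K^{\tilde\xi q+2}}\,dK,\qquad \Pi_t^2=\frac{\tilde\xi(\tilde\xi p-1)}{B_{T,T+\tau}^{\tilde\xi p}}\int_0^\infty C(t,K,T)\frac{dK}{K^{2-\tilde\xi p}},$$ $$\Pi_t^3=B_{t,T}+\int_0^\infty(2\xi+4\xi^2K^2)e^{\xi K^2}C^{vix}(t,K,T)\,dK .$$ They are the time-$t$ values of the static portfolios replicating, respectively, the claim $\frac{1}{qB_{T,T+\tau}}S_{T+\tau}^{-\tilde\xi q}$ paid at $T+\tau$, the claim $\frac1p(F_{T,T+\tau})^{\tilde\xi p}$ paid at $T$, and the claim $e^{\xi\mathrm{VIX}_T^2}$ paid at $T$. Arbitrage at time $t<T$: a self-financing strategy in the traded assets, set up at time $t$ and possibly rearranged at time $T$ at the listed prices, whose entry cost at $t$ is non-positive and whose subsequent cash flows (up to $T+\tau$) are non-negative, with either strictly negative entry cost or positive probability of a strictly positive cash flow. *)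

(* Defs.v *)
From HB Require Import structures.
From mathcomp Require Import all_boot all_order all_algebra.
From mathcomp Require Import all_classical all_reals all_analysis.

Set Implicit Arguments.
Unset Strict Implicit.
Unset Printing Implicit Defensive.
Import Order.TTheory GRing.Theory Num.Theory.
Import numFieldNormedType.Exports.
Local Open Scope classical_set_scope.
Local Open Scope ring_scope.

(* Listed prices are random and depend on the quotation date u, the strike K
   and the maturity T'. They are unrelated to any pricing measure.
   Only strikes K > 0 and dates 0 <= u <= T' are meaningful. The VIX calls all
   mature at the fixed date T. *)
Record market (d : measure_display) (Omega : measurableType d) (R : realType) :=
  Market {
    rate : R;
    tau : R;
    mat : R;                                  (* the fixed date T *)
    info : R -> set (set Omega);              (* filtration *)
    spot : R -> Omega -> R;                   (* S_u *)
    put : R -> R -> R -> Omega -> R;          (* P(u, K, T') *)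
    call : R -> R -> R -> Omega -> R;         (* C(u, K, T') *)
    vixcall : R -> R -> Omega -> R            (* C^vix(u, K, T) *)
  }.

Section market_theory.
Context (d : measure_display) (Omega : measurableType d) (R : realType).
Variable M : market Omega R.
Implicit Types (u v : R) (w : Omega).

Local Notation mu := (@lebesgue_measure R).
Local Notation T := (mat M).

Definition bond u (T' : R) : R := expR (- (rate M * (T' - u))).

Definition futures u (T' : R) w : R := spot M u w / bond u T'.

Definition strikes : set R := [set K | 0 < K].

Definition finite_integral (D : set R) (f : R -> R) : Prop :=
  mu.-integrable D (EFin \o f).

Definition vix_put_integrand w (K : R) : R :=
  put M T K (T + tau M) w / K ^+ 2.

Definition vix_call_integrand w (K : R) : R :=
  call M T K (T + tau M) w / K ^+ 2.

Definition vix_put_strikes w : set R :=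
  [set K | 0 < K < futures T (T + tau M) w].

Definition vix_call_strikes w : set R :=
  [set K | futures T (T + tau M) w < K].

Definition vix_sq w : R :=
  2 / (tau M * bond T (T + tau M)) *
  (\int[mu]_(K in vix_put_strikes w) vix_put_integrand w K +
   \int[mu]_(K in vix_call_strikes w) vix_call_integrand w K).

Definition vix w : R := Num.sqrt (vix_sq w).

(* Measurability with respect to the information available at time u. *)
Definition known_at u (f : Omega -> R) : Prop :=
  measurable_fun [set: g_sigma_algebraType (info M u)]
    (f : g_sigma_algebraType (info M u) -> R).

(* The same for a function of the scenario and of the strike: joint
   measurability for the product of the information at time u and of the
   Borel sigma-algebra on the positive strikes. *)
Definition known_curve_at u (f : Omega -> R -> R) : Prop :=
  measurable_fun ([set: g_sigma_algebraType (info M u)] `*` strikes)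
    (fun x : g_sigma_algebraType (info M u) * R => f x.1 x.2).

Record is_market : Prop := IsMarket {
  rate_ge0 : 0 <= rate M;
  tau_gt0 : 0 < tau M;
  mat_gt0 : 0 < T;
  info_sigma : forall u, 0 <= u -> sigma_algebra setT (info M u);
  info_measurable : forall u, 0 <= u -> info M u `<=` measurable;
  info_mono : forall u v, 0 <= u -> u <= v -> info M u `<=` info M v;
  spot_gt0 : forall u w, 0 <= u -> 0 < spot M u w;
  spot_known : forall u, 0 <= u -> known_at u (spot M u);
  put_known : forall u (T' : R), 0 <= u -> u <= T' ->
    known_curve_at u (fun w K => put M u K T' w);
  call_known : forall u (T' : R), 0 <= u -> u <= T' ->
    known_curve_at u (fun w K => call M u K T' w);
  vixcall_known : forall u, 0 <= u -> u <= T ->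
    known_curve_at u (fun w K => vixcall M u K w);
  put_payoff : forall (T' K : R) w, 0 <= T' -> 0 < K ->
    put M T' K T' w = Num.max (K - spot M T' w) 0;
  call_payoff : forall (T' K : R) w, 0 <= T' -> 0 < K ->
    call M T' K T' w = Num.max (spot M T' w - K) 0;
  vixcall_payoff : forall (K : R) w, 0 < K ->
    vixcall M T K w = Num.max (vix w - K) 0;
  vix_put_finite : forall w,
    finite_integral (vix_put_strikes w) (vix_put_integrand w);
  vix_call_finite : forall w,
    finite_integral (vix_call_strikes w) (vix_call_integrand w);
  (* No sign is imposed on the individual listed prices. *)
  vix_sq_ge0 : forall w, 0 <= vix_sq w
}.

Section portfolios.
Variables xi p q : R.

Definition xit : R := 2 * xi / tau M.

Definition Pi1_integrand u w (K : R) : R :=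
  put M u K (T + tau M) w / K `^ (xit * q + 2).

Definition Pi1 u w : R :=
  xit * (xit * q + 1) / bond T (T + tau M) *
  \int[mu]_(K in strikes) Pi1_integrand u w K.

Definition Pi2_integrand u w (K : R) : R :=
  call M u K T w / K `^ (2 - xit * p).

Definition Pi2 u w : R :=
  xit * (xit * p - 1) / bond T (T + tau M) `^ (xit * p) *
  \int[mu]_(K in strikes) Pi2_integrand u w K.

Definition Pi3_integrand u w (K : R) : R :=
  (2 * xi + 4 * xi ^+ 2 * K ^+ 2) * expR (xi * K ^+ 2) * vixcall M u K w.

Definition Pi3 u w : R :=
  bond u T + \int[mu]_(K in strikes) Pi3_integrand u w K.

Definition finite_portfolios u : Prop := forall w,
  [/\ finite_integral strikes (Pi1_integrand u w),
      finite_integral strikes (Pi2_integrand u w) &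
      finite_integral strikes (Pi3_integrand u w)].

End portfolios.

(* Positions in the instruments maturing at one given date: numbers of bonds
   and of futures, and densities over strikes of puts and calls. All positions
   may be long or short. *)
Record leg := Leg {
  leg_bond : Omega -> R;
  leg_futures : Omega -> R;
  leg_put : Omega -> R -> R;
  leg_call : Omega -> R -> R
}.

Definition leg_known_at u (L : leg) : Prop :=
  [/\ known_at u (leg_bond L), known_at u (leg_futures L),
      known_curve_at u (leg_put L) & known_curve_at u (leg_call L)].

Definition leg_finite u (T' : R) (L : leg) : Prop := forall w,
  finite_integral strikes (fun K => leg_put L w K * put M u K T' w) /\
  finite_integral strikes (fun K => leg_call L w K * call M u K T' w).

(* Price at time u of the leg with maturity T'. Entering futures is free. *)
Definition leg_cost u (T' : R) (L : leg) w : R :=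
  leg_bond L w * bond u T' +
  \int[mu]_(K in strikes) (leg_put L w K * put M u K T' w) +
  \int[mu]_(K in strikes) (leg_call L w K * call M u K T' w).

(* Proceeds at time v from a leg with maturity T' bought at time u, with the
   futures settled at time v. For v = T' this is the payoff of the leg, since
   prices at maturity equal payoffs. *)
Definition leg_value u v (T' : R) (L : leg) w : R :=
  leg_cost v T' L w + leg_futures L w * (futures v T' w - futures u T' w).

(* The portfolio of the first period, [t, T], is made of the underlying, of
   instruments maturing at T and at T + tau, and of a density of VIX calls; that
   of the second period, [T, T + tau], is made of the underlying and of
   instruments maturing at T + tau. *)
Record strategy := Strategy {
  spot0 : Omega -> R;
  near0 : leg;
  far0 : leg;
  vixcall0 : Omega -> R -> R;
  spot1 : Omega -> R;
  far1 : leg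
}.

Definition admissible (t : R) (h : strategy) : Prop :=
  [/\ [/\ known_at t (spot0 h), leg_known_at t (near0 h),
          leg_known_at t (far0 h) & known_curve_at t (vixcall0 h)],
      known_at T (spot1 h) /\ leg_known_at T (far1 h),
      forall u, u = t \/ u = T ->
        [/\ leg_finite u T (near0 h), leg_finite u (T + tau M) (far0 h) &
            forall w, finite_integral strikes
              (fun K => vixcall0 h w K * vixcall M u K w)] &
      forall u, u = T \/ u = T + tau M -> leg_finite u (T + tau M) (far1 h)].

Definition vix_position_cost u (h : strategy) w : R :=
  \int[mu]_(K in strikes) (vixcall0 h w K * vixcall M u K w).

Definition entry_cost (t : R) (h : strategy) w : R :=
  spot0 h w * spot M t w + leg_cost t T (near0 h) w +
  leg_cost t (T + tau M) (far0 h) w + vix_position_cost t h w.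

(* The first portfolio is sold and the second one bought at the prices listed
   at T. *)
Definition flow_T (t : R) (h : strategy) w : R :=
  (spot0 h w * spot M T w + leg_value t T T (near0 h) w +
   leg_value t T (T + tau M) (far0 h) w + vix_position_cost T h w) -
  (spot1 h w * spot M T w + leg_cost T (T + tau M) (far1 h) w).

Definition flow_end (h : strategy) w : R :=
  spot1 h w * spot M (T + tau M) w +
  leg_value T (T + tau M) (T + tau M) (far1 h) w.

(* Prices at time t are random when seen from time 0, so that an arbitrage at
   time t is relative to an event A, known at time t, describing the market
   conditions then. If the information at time t is trivial, A = setT. *)
Definition arbitrage (P : probability Omega R) (t : R) (A : set Omega) : Prop :=
  exists h : strategy,
    [/\ admissible t h,
        forall w, A w -> entry_cost t h w <= 0,
        forall w, A w -> 0 <= flow_T t h w /\ 0 <= flow_end h w &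
        (forall w, A w -> entry_cost t h w < 0) \/
        (0 < P (A `&` [set w | (0 < flow_T t h w)%R \/ (0 < flow_end h w)%R]))%E].

End market_theory.

(* Main.v *)
(* Buy Pi^1 and Pi^2 and sell Pi^3 at time t, which costs a negative amount.
   Write X = 2 xi / tau, F = F_{T,T+tau}, B = B_{T,T+tau}, L = VIX_T^2. At time
   T the debt is, by Young's inequality,
     e^{xi L} = F^X (F^{-X} e^{xi L}) <= F^{Xp} / p + F^{-Xq} e^{q xi L} / q,
   and Pi^2 pays the first term. The second one is borrowed, so that
   a = F^{-Xq} e^{q xi L} / (qB) is due at T + tau. Moreover a q xi units of
   the log contract, which pays -(2/tau) log(S_{T+tau}/F) and has future value
   L, are sold forward at no cost. The puts of Pi^1 cover the final liability,
   since the exponential lies above its tangent: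
     S^{-Xq} >= F^{-Xq} e^{q xi L} (1 + q xi (-(2/tau) log(S/F) - L)). *)
Require Import Defs.
From HB Require Import structures.
From mathcomp Require Import all_boot all_order all_algebra.
From mathcomp Require Import all_classical all_reals all_analysis.
From mathcomp Require Import measurable_realfun.
From mathcomp Require Import ring lra.
Set Implicit Arguments.
Unset Strict Implicit.
Unset Printing Implicit Defensive.
Import Order.TTheory GRing.Theory Num.Theory.
Import numFieldNormedType.Exports.
Local Open Scope classical_set_scope.
Local Open Scope ring_scope.

(** * Integrals carried with their value, and the fundamental theorem of calculus *)

Section integration.
Context {R : realType}.
Local Notation mu := (@lebesgue_measure R).
Implicit Types (D : set R) (f g F : R -> R) (a b v : R).

(** The real integral has a default value when [f] is not integrable, so integrability and value
    travel together: admissibility of the strategy uses the first half, its cash flows the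
    second. *)
Definition has_Rintegral D f v : Prop :=
  mu.-integrable D (EFin \o f) /\ \int[mu]_(x in D) f x = v.

(** Both sides are compared after extension by zero to the whole line, which allows the domain to
    change along with the integrand. *)
Lemma has_Rintegral_patch D D' f g v : measurable D -> measurable D' ->
  f \_ D =1 g \_ D' -> has_Rintegral D' g v -> has_Rintegral D f v.
Proof.
move=> mD mD' /funext fg [ig <-]; split.
  have [_] := integrable_mkcond (mu := mu) (EFin \o f) mD; apply.
  have [+ _] := integrable_mkcond (mu := mu) (EFin \o g) mD'.
  by rewrite !restrict_EFin fg; apply.
by rewrite Rintegral_mkcond fg -Rintegral_mkcond.
Qed.

Lemma has_RintegralD D f g u v : measurable D ->
  has_Rintegral D f u -> has_Rintegral D g v ->
  has_Rintegral D (fun x => f x + g x) (u + v).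
Proof.
move=> mD [intf <-] [intg <-]; split; last by rewrite RintegralD.
exact: (integrableD (mu := mu) mD intf intg).
Qed.

Lemma has_RintegralZl D f v k : measurable D ->
  has_Rintegral D f v -> has_Rintegral D (fun x => k * f x) (k * v).
Proof.
move=> mD [intf <-]; split; last by rewrite RintegralZl.
exact: (integrableZl (mu := mu) mD k intf).
Qed.

Lemma eq_has_Rintegral D f g v : measurable D -> (forall x, D x -> f x = g x) ->
  has_Rintegral D g v -> has_Rintegral D f v.
Proof.
move=> mD fg; apply: has_Rintegral_patch => // x; rewrite !patchE.
by case: ifPn => // /set_mem /fg.
Qed.

Lemma has_Rintegral0 D f : measurable D -> (forall x, D x -> f x = 0) ->
  has_Rintegral D f 0.
Proof.
move=> mD f0; apply: (@eq_has_Rintegral _ _ (cst 0)) => //; split.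
  exact: integrable0.
by rewrite Rintegral_cst// mul0r.
Qed.

Lemma is_derive_cvg f (x df : R) : is_derive x 1 f df -> f y @[y --> x] --> f x.
Proof.
by move=> [fx _]; apply: differentiable_continuous; exact/derivable1_diffP.
Qed.

Lemma has_Rintegral_FTC f F a b : a <= b ->
  (forall x, a <= x <= b -> {for x, continuous f}) ->
  (forall x, a <= x <= b -> is_derive x 1 F (f x)) ->
  has_Rintegral `]a, b] f (F b - F a).
Proof.
(* The degenerate case, where the half-open interval is empty, does occur: the VIX may be zero. *)
rewrite le_eqVlt => /predU1P[<- _ _|ab cf dF].
  by rewrite subrr set_itvoc0; apply: has_Rintegral0.
have cfab : {within `[a, b], continuous f}.
  apply: continuous_in_subspaceT => x /set_mem /=; rewrite in_itv/=.
  exact: cf.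
have intf : mu.-integrable `]a, b] (EFin \o f).
  apply: (integrableS (mu := mu) (E := `[a, b])) => //.
    by apply: subset_itv; rewrite bnd_simp.
  by apply: continuous_compact_integrable => //; exact: segment_compact.
split=> //; rewrite Rintegral_itv_obnd_cbnd// /Rintegral.
rewrite (continuous_FTC2 ab cfab (F := F))//.
  split.
  - move=> x /[!in_itv]/= /andP[/ltW ax /ltW xb].
    by apply: ex_derive; apply: dF; rewrite ax.
  - apply: cvg_at_right_filter; apply: is_derive_cvg; apply: dF.
    by rewrite lexx ltW.
  - apply: cvg_at_left_filter; apply: is_derive_cvg; apply: dF.
    by rewrite lexx ltW.
move=> x /[!in_itv]/= /andP[/ltW ax /ltW xb].
by rewrite derive1E; apply: derive_val; apply: dF; rewrite ax.
Qed.

Lemma ge0_has_Rintegral D f v : measurable D -> measurable_fun D f ->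
  (forall x, D x -> 0 <= f x) -> (\int[mu]_(x in D) (f x)%:E)%E = v%:E ->
  has_Rintegral D f v.
Proof.
move=> mD mf f0 intf; split; last by rewrite /Rintegral intf.
apply/integrableP; split; first exact/measurable_EFinP.
rewrite (_ : (\int[mu]_(x in D) _)%E = v%:E) ?ltry// -intf.
by apply: eq_integral => x /set_mem Dx /=; rewrite ger0_norm ?f0.
Qed.

Lemma has_Rintegral_FTCy f F a (l : R) :
  (forall x, a <= x -> 0 <= f x) ->
  (forall x, a <= x -> {for x, continuous f}) ->
  (forall x, a <= x -> is_derive x 1 F (f x)) ->
  F x @[x --> +oo] --> l ->
  has_Rintegral `[a, +oo[ f (l - F a).
Proof.
move=> f0 cf dF Fl.
have cfa : {within `[a, +oo[, continuous f}.
  apply: continuous_in_subspaceT => x /set_mem /=; rewrite in_itv andbT.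
  exact: cf.
apply: ge0_has_Rintegral => //.
- exact: subspace_continuous_measurable_fun.
- by move=> x /=; rewrite in_itv andbT; exact: f0.
rewrite (ge0_continuous_FTC2y f0 cfa Fl)//.
- by move=> x /ltW ax; apply: ex_derive; exact: dF.
- by apply: cvg_at_right_filter; apply: is_derive_cvg; exact: dF.
- move=> x; rewrite in_itv/= andbT => /ltW ax.
  by rewrite derive1E; apply: derive_val; exact: dF.
Qed.

(** Since [f] may blow up at [a], the interval is exhausted by the segments from [a + 1/(n+1)] to
    [b], and monotone convergence applies. *)
Lemma has_Rintegral_FTC_at_right f F a b (l : R) : a < b ->
  (forall x, a < x <= b -> 0 <= f x) ->
  (forall x, a < x <= b -> {for x, continuous f}) ->
  (forall x, a < x <= b -> is_derive x 1 F (f x)) ->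
  F x @[x --> a^'+] --> l ->
  has_Rintegral `]a, b] f (F b - l).
Proof.
move=> ab f0 cf dF Fl.
have an_gt n : a < a + n.+1%:R^-1 by rewrite ltrDl invr_gt0.
have cfn n : {within `[(a + n.+1%:R^-1), b], continuous f}.
  apply: continuous_in_subspaceT => x /set_mem /=; rewrite in_itv/=.
  by move=> /andP[anx xb]; apply: cf; rewrite xb (lt_le_trans (an_gt n)).
have mfn n : measurable_fun `[(a + n.+1%:R^-1), b] f.
  exact: subspace_continuous_measurable_fun.
apply: ge0_has_Rintegral => //.
- by rewrite itv_open_bnd_bigcup; apply/measurable_fun_bigcup.
rewrite itv_open_bnd_bigcup.
have cvgI := ge0_nondecreasing_set_cvg_integral
  (T := measurableTypeR R) (mu := mu)
  (F := fun n => [set` `[a + n.+1%:R^-1, b]]) (f := EFin \o f).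
(* By uniqueness of limits it remains to check that the integrals over the segments tend to
   [F b - l]. *)
apply/(cvg_unique _ (cvgI _ _ _ _)) => //=.
- move=> m n mn; rewrite subsetEset; apply: subset_itv; rewrite bnd_simp//.
  by rewrite lerD2l lef_pV2 ?posrE// ler_nat.
- by move=> n; apply/measurable_EFinP; exact: mfn.
- move=> n x; rewrite in_itv/= => /andP[anx xb].
  by rewrite lee_fin f0// xb (lt_le_trans (an_gt n)).
have ba : 0 < b - a by rewrite subr_gt0.
have cvgF : (F b - F (a + n.+1%:R^-1))%:E @[n --> \oo] --> (F b - l)%:E.
  apply: cvg_EFin; first exact: nearW.
  apply: cvgB; first exact: cvg_cst.
  move/cvg_at_rightP : Fl; apply; split=> //.
  rewrite -[X in _ --> X]addr0; apply: cvgD; first exact: cvg_cst.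
  exact: cvg_harmonic.
(* The segment is nonempty, and the fundamental theorem applies to it, only for large [n]. *)
apply: cvg_trans cvgF; apply: near_eq_cvg; near=> n.
have anb : a + n.+1%:R^-1 <= b.
  rewrite -lerBrDl ltW//; near: n.
  exact: (near_infty_natSinv_lt (PosNum ba)).
have anx x : a + n.+1%:R^-1 <= x <= b -> a < x <= b.
  by move=> /andP[anx ->]; rewrite (lt_le_trans (an_gt n)).
have [intn <-] := has_Rintegral_FTC anb (fun x xab => cf x (anx x xab))
  (fun x xab => dF x (anx x xab)).
rewrite -integral_itv_obnd_cbnd ?fineK//; first exact: integrable_fin_num.
exact: (measurable_int mu).
Unshelve. all: end_near.
Qed.

(** Meant for payoffs: [D] is the set of all strikes, and [D'] an interval of strikes outside which
    the integrand vanishes. *)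
Lemma has_Rintegral_subset D D' f g v : measurable D -> measurable D' ->
  D' `<=` D -> (forall x, D' x -> f x = g x) ->
  (forall x, D x -> ~ D' x -> f x = 0) ->
  has_Rintegral D' g v -> has_Rintegral D f v.
Proof.
move=> mD mD' D'D fg f0; apply: has_Rintegral_patch => // x; rewrite !patchE.
have [D'x|D'x] := pselect (D' x).
  by rewrite !mem_set//; [exact: fg|exact: D'D].
rewrite (memNset D'x); case: ifPn => // /set_mem Dx; exact: f0.
Qed.

(** * Limits and derivatives of explicit functions *)

Lemma powRN_cvgy (a : R) : 0 < a -> x `^ (- a) @[x --> +oo] --> 0.
Proof.
move=> a0; apply/cvgr0Pnorm_lt => e e0; near=> x.
have x0 : 0 < x by near: x; exact: nbhs_pinfty_gt.
rewrite ger0_norm ?powR_ge0// powRN -[ltRHS]invrK.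
rewrite ltf_pV2 ?posrE ?powR_gt0 ?invr_gt0//.
(* This exhibits the threshold that [x] has to exceed. *)
have -> : e^-1 = (e^-1 `^ a^-1) `^ a.
  by rewrite -powRrM mulVf ?powRr1 ?invr_ge0 ?ltW// gt_eqF.
apply: gt0_ltr_powR => //; rewrite ?nnegrE ?powR_ge0 ?ltW//.
Unshelve. all: end_near.
Qed.

Lemma strikesE : @strikes R = [set` `]0, +oo[].
Proof. by apply/seteqP; split=> x; rewrite /strikes /= in_itv/= andbT. Qed.

Lemma measurable_strikes : measurable (@strikes R).
Proof. by rewrite strikesE. Qed.
Hint Resolve measurable_strikes : core.

(** This rule and the next ones state the functions pointwise, the form in which [derive_fun] meets
    them. *)
Lemma is_derive_cst_fun (c x : R) : is_derive x 1 (fun _ : R => c) 0.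
Proof. exact: is_derive_cst. Qed.

Lemma is_derive_id_fun (x : R) : is_derive x 1 (fun y : R => y) 1.
Proof. exact: is_derive_id. Qed.

Lemma is_deriveD_fun f g (x df dg : R) :
  is_derive x 1 f df -> is_derive x 1 g dg ->
  is_derive x 1 (fun y => f y + g y) (df + dg).
Proof. exact: is_deriveD. Qed.

Lemma is_deriveN_fun f (x df : R) :
  is_derive x 1 f df -> is_derive x 1 (fun y => - f y) (- df).
Proof. exact: is_deriveN. Qed.

Lemma is_deriveM_fun f g (x df dg : R) :
  is_derive x 1 f df -> is_derive x 1 g dg ->
  is_derive x 1 (fun y => f y * g y) (f x * dg + g x * df).
Proof. exact: is_deriveM. Qed.

Lemma is_derive_expR_fun f (x df : R) :
  is_derive x 1 f df -> is_derive x 1 (fun y => expR (f y)) (expR (f x) * df).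
Proof. by move=> dfx; apply: is_derive1_comp. Qed.

(* [apply:] would run instance resolution on every premise, which is very slow
   on these goals. *)
Ltac derive_fun := repeat first
  [ notypeclasses refine (is_derive_cst_fun _ _)
  | notypeclasses refine (is_derive_id_fun _)
  | notypeclasses refine (is_deriveD_fun _ _)
  | notypeclasses refine (is_deriveN_fun _)
  | notypeclasses refine (is_deriveM_fun _ _)
  | notypeclasses refine (is_derive_expR_fun _)
  | notypeclasses refine (is_derive1_powR _ _)
  | notypeclasses refine (is_derive1_ln _) ].

(** * Strips of options replicating powers and the exponential of a square *)

Lemma powRD1 (x c : R) : 0 < x -> x `^ (c + 1) = x * x `^ c.
Proof.
move=> x0; rewrite powRD; last by rewrite (gt_eqF x0) implybT.
by rewrite powRr1 1?mulrC// ltW.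
Qed.

(** The second derivative of [S^(-a)] is [a(a+1) S^(-a-2)], and the function vanishes with its slope
    at infinity, so puts alone replicate it. With [a = X q] this is the final payoff of Pi^1. *)
Lemma has_Rintegral_put_power (a S : R) : 0 < a -> 0 < S ->
  has_Rintegral (@strikes R) (fun K => Num.max (K - S) 0 / K `^ (a + 2))
    (S `^ (- a) / (a * (a + 1))).
Proof.
move=> a0 S0.
(* A primitive of the integrand on the strikes above [S]; both terms tend to 0 at infinity. *)
pose F K := (S / (a + 1)) * K `^ (- (a + 1)) - a^-1 * K `^ (- a).
have a1 : a + 1 != 0 by rewrite gt_eqF// addr_gt0.
have an0 : a != 0 by rewrite gt_eqF.
pose g K := (K - S) * K `^ (- (a + 2)).
have dF x : S <= x -> is_derive x 1 F (g x).
  move=> Sx; have x0 : 0 < x by exact: lt_le_trans Sx.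
  rewrite /F /g; notypeclasses refine (is_derive_eq _ _); first by derive_fun.
  have -> : - (a + 1) - 1 = - (a + 2) by ring.
  have -> : - a - 1 = - (a + 2) + 1 by ring.
  by rewrite powRD1//; field; rewrite ?an0 ?a1.
have Fl : F x @[x --> +oo] --> 0.
  rewrite (_ : 0 = S / (a + 1) * 0 - a^-1 * 0); last by ring.
  apply: cvgB; apply: cvgM; try exact: cvg_cst; apply: powRN_cvgy => //.
  by rewrite addr_gt0.
have cg : forall x, S <= x -> {for x, continuous g}.
  move=> x Sx; have x0 : 0 < x by exact: lt_le_trans Sx.
  by notypeclasses refine (is_derive_cvg _); derive_fun.
have g0 x : S <= x -> 0 <= g x.
  by move=> Sx; rewrite mulr_ge0 ?powR_ge0// subr_ge0.
apply: (has_Rintegral_subset (D' := [set` `[S, +oo[]) (g := g)) => //.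
- by move=> x /=; rewrite in_itv/= andbT => /(lt_le_trans S0).
- move=> x /=; rewrite in_itv/= andbT => Sx.
  by rewrite /g powRN max_l// subr_ge0.
- move=> x _ /negP; rewrite in_itv/= andbT -ltNge => /ltW xS.
  by rewrite max_r ?mul0r// subr_le0.
have -> : S `^ (- a) / (a * (a + 1)) = 0 - F S.
  rewrite /F (_ : - a = - (a + 1) + 1); last by ring.
  by rewrite powRD1//; field; rewrite ?an0 ?a1.
exact: has_Rintegral_FTCy.
Qed.

(** For [b > 1] the function [S^b] vanishes with its slope at 0, so calls alone replicate it. For
    [b < 2] the density is singular at strike 0, hence the version of the fundamental theorem with a
    limit at the left end. *)
Lemma has_Rintegral_call_power (b S : R) : 1 < b -> 0 < S ->
  has_Rintegral (@strikes R) (fun K => Num.max (S - K) 0 / K `^ (2 - b))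
    (S `^ b / (b * (b - 1))).
Proof.
move=> b1 S0.
have b10 : 0 < b - 1 by rewrite subr_gt0.
have b0 : 0 < b by exact: lt_trans b1.
have b1n0 : b - 1 != 0 by rewrite gt_eqF.
have bn0 : b != 0 by rewrite gt_eqF.
pose F K := (S / (b - 1)) * K `^ (b - 1) - b^-1 * K `^ b.
pose g K := (S - K) * K `^ (- (2 - b)).
have dF x : 0 < x <= S -> is_derive x 1 F (g x).
  move=> /andP[x0 xS].
  rewrite /F /g; notypeclasses refine (is_derive_eq _ _); first by derive_fun.
  have -> : x `^ (b - 1) = x * x `^ (- (2 - b)).
    by rewrite -powRD1//; congr (_ `^ _); ring.
  have -> : b - 1 - 1 = - (2 - b) by ring.
  by field; rewrite ?bn0 ?b1n0.
have Fl : F x @[x --> 0^'+] --> 0.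
  rewrite [X in _ --> X](_ : 0 = S / (b - 1) * 0 - b^-1 * 0); last by ring.
  by apply: cvgB; apply: cvgM; try exact: cvg_cst; apply: powR_cvg0.
have cg : forall x, 0 < x <= S -> {for x, continuous g}.
  by move=> x /andP[x0 _]; notypeclasses refine (is_derive_cvg _); derive_fun.
have g0 x : 0 < x <= S -> 0 <= g x.
  by move=> /andP[_ xS]; rewrite mulr_ge0 ?powR_ge0// subr_ge0.
apply: (has_Rintegral_subset (D' := [set` `]0, S]]) (g := g)) => //.
- by move=> x /=; rewrite in_itv/= => /andP[].
- move=> x /=; rewrite in_itv/= => /andP[x0 xS].
  by rewrite /g powRN max_l// subr_ge0.
- move=> x /= x0 /negP; rewrite in_itv/= x0/= -ltNge => /ltW xS.
  by rewrite max_r ?mul0r// subr_le0.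
have -> : S `^ b / (b * (b - 1)) = F S - 0.
  have -> : S `^ b = S * S `^ (b - 1) by rewrite -powRD1// subrK.
  rewrite /F; have -> : S `^ b = S * S `^ (b - 1) by rewrite -powRD1// subrK.
  by field; rewrite ?bn0 ?b1n0.
exact: has_Rintegral_FTC_at_right.
Qed.

(** The density is the second derivative of [f(K) = e^(xi K^2)], whose slope at 0 is zero. The
    missing [f(0) = 1] is the payoff of the bond in Pi^3. *)
Lemma has_Rintegral_call_expR_sq (xi V : R) : 0 <= V ->
  has_Rintegral (@strikes R)
    (fun K => (2 * xi + 4 * xi ^+ 2 * K ^+ 2) * expR (xi * K ^+ 2) *
       Num.max (V - K) 0) (expR (xi * V ^+ 2) - 1).
Proof.
move=> V0.
(* This is [f'(K) (V - K) + f(K)], whose derivative is [f''(K) (V - K)]. *)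
pose F K := 2 * xi * K * expR (xi * (K * K)) * (V - K) + expR (xi * (K * K)).
pose g K := (2 * xi + 4 * xi ^+ 2 * (K * K)) * expR (xi * (K * K)) * (V - K).
have dF (x : R) : is_derive x 1 F (g x).
  rewrite /F /g; notypeclasses refine (is_derive_eq _ _); first by derive_fun.
  by rewrite /GRing.scale /=; ring.
have cg : forall x, {for x, continuous g}.
  by move=> x; notypeclasses refine (is_derive_cvg _); derive_fun.
apply: (has_Rintegral_subset (D' := [set` `]0, V]]) (g := g)) => //.
- by move=> x /=; rewrite in_itv/= => /andP[].
- move=> x /=; rewrite in_itv/= => /andP[x0 xV].
  by rewrite max_l ?subr_ge0// /g expr2.
- move=> x /= x0 /negP; rewrite in_itv/= x0/= -ltNge => /ltW xV.
  by rewrite max_r ?mulr0// subr_le0.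
have -> : expR (xi * V ^+ 2) - 1 = F V - F 0.
  by rewrite /F !mulr0 !mul0r expR0 subrr mulr0 !add0r expr2.
exact: has_Rintegral_FTC.
Qed.

(** * Strips of options replicating the logarithm *)

Lemma has_Rintegral_itv_bndo f a b v :
  has_Rintegral [set` `]a, b]] f v -> has_Rintegral [set` `]a, b[] f v.
Proof.
move=> [intf <-].
have intf' : mu.-integrable [set` `]a, b[] (EFin \o f).
  apply: (integrableS (mu := mu) (E := [set` `]a, b]])) => //.
  by apply: subset_itv; rewrite bnd_simp.
by split=> //; rewrite Rintegral_itv_bndo_bndc.
Qed.

Lemma is_derive_ln_inv (S x : R) : 0 < x ->
  is_derive x 1 (fun y => ln y + S * y `^ (- 1)) ((x - S) / x ^+ 2).
Proof.
move=> x0; notypeclasses refine (is_derive_eq _ _); first by derive_fun.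
have -> : -1 - 1 = - 2%:R :> R by ring.
by rewrite powR_invn ?ltW//; field; rewrite gt_eqF.
Qed.

Lemma continuous_div_sq (S x : R) : 0 < x ->
  {for x, continuous (fun y : R => (y - S) / y ^+ 2)}.
Proof.
move=> x0; apply: cvgM; first by apply: cvgB; [exact: cvg_id|exact: cvg_cst].
by apply: cvgV; [rewrite expf_eq0 gt_eqF|exact: exprn_continuous].
Qed.

Lemma has_Rintegral_put_log (S F : R) : 0 < S -> 0 < F ->
  has_Rintegral (@strikes R)
    (fun K => if K < F then Num.max (K - S) 0 / K ^+ 2 else 0)
    (if S < F then (S - F) / F - ln (S / F) else 0).
Proof.
move=> S0 F0; case: ltP => [SF|FS]; last first.
  apply: has_Rintegral0 => // x _; case: ifPn => // xF.
  by rewrite max_r ?mul0r// subr_le0 (le_trans (ltW xF)).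
pose g K := (K - S) / K ^+ 2.
apply: (has_Rintegral_subset (D' := [set` `]S, F[]) (g := g)) => //.
- by move=> x /=; rewrite in_itv/= => /andP[Sx _]; exact: lt_trans Sx.
- move=> x /=; rewrite in_itv/= => /andP[Sx ->].
  by rewrite max_l// subr_ge0 ltW.
- move=> x /= x0 /negP; rewrite in_itv/= => xSF; case: ifPn => // xF.
  by move: xSF; rewrite xF andbT -leNgt => xS; rewrite max_r ?mul0r// subr_le0.
have -> : (S - F) / F - ln (S / F) =
    (ln F + S * F `^ (- 1)) - (ln S + S * S `^ (- 1)).
  rewrite lnM ?lnV ?posrE ?invr_gt0// !powR_inv1 ?ltW//.
  by field; rewrite !gt_eqF.
apply/has_Rintegral_itv_bndo.
apply: (has_Rintegral_FTC (F := fun y => ln y + S * y `^ (- 1))).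
- exact: ltW.
- by move=> x /andP[Sx _]; apply: continuous_div_sq; exact: lt_le_trans Sx.
- by move=> x /andP[Sx _]; apply: is_derive_ln_inv; exact: lt_le_trans Sx.
Qed.

Lemma has_Rintegral_call_log (S F : R) : 0 < S -> 0 < F ->
  has_Rintegral (@strikes R)
    (fun K => if F < K then Num.max (S - K) 0 / K ^+ 2 else 0)
    (if F < S then (S - F) / F - ln (S / F) else 0).
Proof.
move=> S0 F0; case: ltP => [FS|SF]; last first.
  apply: has_Rintegral0 => // x _; case: ifPn => // xF.
  by rewrite max_r ?mul0r// subr_le0 (le_trans SF)// ltW.
pose g K := - 1 * ((K - S) / K ^+ 2).
apply: (has_Rintegral_subset (D' := [set` `]F, S]]) (g := g)) => //.
- by move=> x /=; rewrite in_itv/= => /andP[Sx _]; exact: lt_trans Sx.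
- move=> x /=; rewrite in_itv/= => /andP[-> xS].
  by rewrite max_l ?subr_ge0// /g mulN1r -mulNr opprB.
- move=> x /= x0 /negP; rewrite in_itv/= => xSF; case: ifPn => // xF.
  move: xSF; rewrite xF /= -ltNge => /ltW xS.
  by rewrite max_r ?mul0r// subr_le0.
have -> : (S - F) / F - ln (S / F) =
    - 1 * ((ln S + S * S `^ (- 1)) - (ln F + S * F `^ (- 1))).
  rewrite lnM ?lnV ?posrE ?invr_gt0// !powR_inv1 ?ltW//.
  by field; rewrite !gt_eqF.
apply: has_RintegralZl => //.
apply: (has_Rintegral_FTC (F := fun y => ln y + S * y `^ (- 1))).
- exact: ltW.
- by move=> x /andP[Sx _]; apply: continuous_div_sq; exact: lt_le_trans Sx.
- by move=> x /andP[Sx _]; apply: is_derive_ln_inv; exact: lt_le_trans Sx.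
Qed.

(** Only one of the two strips ends in the money, and at [S = F] the payoff is zero. *)
Lemma put_call_log_payoff (S F : R) : 0 < S -> 0 < F ->
  (if S < F then (S - F) / F - ln (S / F) else 0) +
  (if F < S then (S - F) / F - ln (S / F) else 0) = (S - F) / F - ln (S / F).
Proof.
move=> S0 F0; case: ltgtP => // [||->]; rewrite ?addr0 ?add0r//.
by rewrite subrr mul0r divff ?gt_eqF// ln1 subr0.
Qed.

(** * Measurability of integrals depending on a parameter *)

Lemma measurable_Rintegral dG (G : measurableType dG) (h : G * R -> R) :
  measurable_fun setT h ->
  measurable_fun setT (fun w => \int[mu]_(K in setT) h (w, K)).
Proof.
move=> mh; have mEh : measurable_fun setT (EFin \o h) by apply/measurable_EFinP.
rewrite /Rintegral; apply: measurableT_comp => //.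
under eq_fun do rewrite integralE.
(* Tonelli's theorem is applied to the positive and the negative part separately. *)
apply: emeasurable_funB.
  have H :=
    measurable_fun_fubini_tonelli_F (m2 := mu) _ (measurable_funepos mEh).
  apply: eq_measurable_fun (H (fun x => funepos_ge0 _ x)) => x _.
  by rewrite /fubini_F; apply: eq_integral => y _; rewrite !funeposE.
have H := measurable_fun_fubini_tonelli_F (m2 := mu) _ (measurable_funeneg mEh).
apply: eq_measurable_fun (H (fun x => funeneg_ge0 _ x)) => x _.
by rewrite /fubini_F; apply: eq_integral => y _; rewrite !funenegE.
Qed.

(** The domain of integration may depend on the scenario, as the VIX strips do through the futures
    price. The Boolean [b] encodes it, and extension by zero makes the domain constant. *)
Lemma measurable_Rintegral_section dG (G : measurableType dG)
    (D : set R) (f : G -> R -> R) (b : G * R -> bool) :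
  measurable D -> measurable_fun setT b -> (forall w K, b (w, K) -> D K) ->
  measurable_fun (setT `*` D) (fun x : G * R => f x.1 x.2) ->
  measurable_fun setT (fun w => \int[mu]_(K in [set K | b (w, K)]) f w K).
Proof.
move=> mD mb bD mf.
have mB : measurable [set x | b x].
  by have := mb measurableT [set true] I; rewrite setTI.
apply: (eq_measurable_fun (fun w =>
    \int[mu]_(K in setT)
      ((fun x : G * R => f x.1 x.2) \_ [set x | b x]) (w, K))).
  move=> w _; rewrite [RHS]Rintegral_mkcond; apply: eq_Rintegral => K _.
  by rewrite !patchE !mem_setE.
apply: measurable_Rintegral; apply/measurable_restrict => //.
by apply: measurable_funS mf => [|[w K] [_ /bD]] //; exact: measurableX.
Qed.

End integration.

(** * The VIX is known at time T *)

Section strategy.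
Context (d : measure_display) (Omega : measurableType d) (R : realType).
Context (M : market Omega R) (hM : is_market M).
Local Notation mu := (@lebesgue_measure R).
Local Notation T := (mat M).
Local Notation T' := (mat M + tau M).
Local Notation GT := (g_sigma_algebraType (info M T)).

Lemma measurable_curve_powR (dG : measure_display) (G : measurableType dG)
    (D : set (G * R)) (c : R) :
  measurable_fun D (fun x => x.2 `^ c).
Proof.
apply: measurable_funTS.
exact: (measurableT_comp (measurable_powR c) measurable_snd).
Qed.

Lemma futures_gt0 w : 0 < futures M T T' w.
Proof.
by rewrite divr_gt0 ?expR_gt0// (spot_gt0 hM)// ltW// (mat_gt0 hM).
Qed.

Lemma futures_known : known_at M T (futures M T T').
Proof.
apply: measurable_funM => //; apply: (spot_known hM).
exact: ltW (mat_gt0 hM).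
Qed.

Lemma div_sq_known (f : Omega -> R -> R) :
  known_curve_at M T f -> known_curve_at M T (fun w K => f w K / K ^+ 2).
Proof.
move=> mf; apply: (eq_measurable_fun
    (fun x : GT * R => f x.1 x.2 * x.2 `^ (- 2%:R))).
  move=> [w K] /set_mem[_ /=]; rewrite /strikes /= => K0.
  by rewrite powR_invn ?ltW.
apply: measurable_funM mf _; exact: measurable_curve_powR.
Qed.

Lemma mat_le_mat_tau : T <= T'.
Proof. by rewrite lerDl ltW// (tau_gt0 hM). Qed.

(** The loan and the log position taken at T depend on L, so they are legitimate only if L is
    observable then. *)
Lemma vix_sq_known : known_at M T (vix_sq M).
Proof.
have T0 : 0 <= T by exact: ltW (mat_gt0 hM).
have mF : measurable_fun setT (fun x : GT * R => futures M T T' x.1).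
  exact: (measurableT_comp futures_known measurable_fst).
have mput : measurable_fun setT (fun w : GT =>
    \int[mu]_(K in vix_put_strikes M w) vix_put_integrand M w K).
  have := measurable_Rintegral_section (f := vix_put_integrand M : GT -> R -> R)
    (b := fun x : GT * R => 0 < x.2 < futures M T T' x.1) measurable_strikes.
  apply.
  + apply: measurable_and; apply: measurable_fun_ltr => //;
    exact: measurable_snd.
  + by move=> w K /andP[].
  + by apply: (div_sq_known (put_known hM T0 mat_le_mat_tau)).
have mcall : measurable_fun setT (fun w : GT =>
    \int[mu]_(K in vix_call_strikes M w) vix_call_integrand M w K).
  have := measurable_Rintegral_section (f := vix_call_integrand M : GT -> R -> R)
    (b := fun x : GT * R => futures M T T' x.1 < x.2) measurable_strikes.
  apply.
  + by apply: measurable_fun_ltr => //; exact: measurable_snd.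
  + by move=> w K /=; apply: lt_trans; exact: futures_gt0.
  + by apply: (div_sq_known (call_known hM T0 mat_le_mat_tau)).
by apply: measurable_funM => //; apply: measurable_funD.
Qed.

(** * The strategy and the integrals of its positions *)

Context (xi p q : R) (hxi : 0 < xi) (hp : 1 < p) (hq : 1 < q)
  (hpq : p^-1 + q^-1 = 1) (hxip : 1 < xit M xi * p).
Local Notation X := (xit M xi).
Local Notation B := (bond M T T').
Local Notation F := (futures M T T').
Local Notation L := (vix_sq M).

Definition put_coef : R := X * (X * q + 1) / B.
Definition call_coef : R := X * (X * p - 1) / B `^ (X * p).

(* Face value at T + tau of the loan taken at T. *)
Definition loan w : R := F w `^ (- (X * q)) * expR (q * xi * L w) / (q * B).
(* Units sold of -log(S/F), through its Carr-Madan decomposition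
   -(S - F)/F + int_0^F (K - S)^+ dK/K^2 + int_F^oo (S - K)^+ dK/K^2. *)
Definition log_position w : R := loan w * q * X.

(** The calls of Pi^2, together with the bond of Pi^3 sold short. *)
Definition near_leg : leg Omega R :=
  Leg (fun=> -1) (fun=> 0) (fun _ _ => 0)
    (fun _ K => call_coef * K `^ (- (2 - X * p))).

Definition far_leg : leg Omega R :=
  Leg (fun=> 0) (fun=> 0) (fun _ K => put_coef * K `^ (- (X * q + 2)))
    (fun _ _ => 0).

(** The bonds combine the debt [- loan] with the forward price [loan * q * xi * L] received for the
    log contracts. The puts of Pi^1 are kept, and the other positions are the Carr-Madan
    decomposition with reversed sign, its linear term held in futures. *)
Definition hedge_leg : leg Omega R :=
  Leg (fun w => loan w * (q * xi * L w - 1))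
    (fun w => log_position w * F w `^ (- 1))
    (fun w K => put_coef * K `^ (- (X * q + 2)) -
       (if K < F w then log_position w * K `^ (- 2%:R) else 0))
    (fun w K => if F w < K then - log_position w * K `^ (- 2%:R) else 0).

Definition vix_density (_ : Omega) (K : R) : R :=
  - 1 * ((2 * xi + 4 * xi ^+ 2 * K ^+ 2) * expR (xi * K ^+ 2)).

Definition hedge : strategy Omega R :=
  Strategy (fun=> 0) near_leg far_leg vix_density (fun=> 0) hedge_leg.

(** The price curve [P] is left arbitrary, here and in the next lemmas, so as to cover listed prices
    and final payoffs alike. *)
Lemma hedge_put_integral (P : R -> R) w I J :
  has_Rintegral (@strikes R) (fun K => P K / K `^ (X * q + 2)) I ->
  has_Rintegral (@strikes R) (fun K => if K < F w then P K / K ^+ 2 else 0) J ->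
  has_Rintegral (@strikes R) (fun K => leg_put hedge_leg w K * P K)
    (put_coef * I + - log_position w * J).
Proof.
move=> hI hJ; have mS := @measurable_strikes R.
apply: eq_has_Rintegral (has_RintegralD mS (has_RintegralZl put_coef mS hI)
  (has_RintegralZl (- log_position w) mS hJ)) => // K K0 /=.
rewrite powRN; case: ifPn => _; last by ring.
by rewrite powR_invn ?ltW//; ring.
Qed.

Lemma hedge_call_integral (P : R -> R) w J :
  has_Rintegral (@strikes R) (fun K => if F w < K then P K / K ^+ 2 else 0) J ->
  has_Rintegral (@strikes R) (fun K => leg_call hedge_leg w K * P K)
    (- log_position w * J).
Proof.
move=> hJ; have mS := @measurable_strikes R.
apply: eq_has_Rintegral (has_RintegralZl (- log_position w) mS hJ) => //.
move=> K K0 /=.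
by case: ifPn => _; [rewrite powR_invn ?ltW//|]; ring.
Qed.

Lemma far_put_integral (P : R -> R) w I :
  has_Rintegral (@strikes R) (fun K => P K / K `^ (X * q + 2)) I ->
  has_Rintegral (@strikes R) (fun K => leg_put far_leg w K * P K)
    (put_coef * I).
Proof.
move=> hI; have mS := @measurable_strikes R.
apply: eq_has_Rintegral (has_RintegralZl put_coef mS hI) => // K K0 /=.
by rewrite powRN; ring.
Qed.

Lemma near_call_integral (P : R -> R) w I :
  has_Rintegral (@strikes R) (fun K => P K / K `^ (2 - X * p)) I ->
  has_Rintegral (@strikes R) (fun K => leg_call near_leg w K * P K)
    (call_coef * I).
Proof.
move=> hI; have mS := @measurable_strikes R.
apply: eq_has_Rintegral (has_RintegralZl call_coef mS hI) => // K K0 /=.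
by rewrite powRN; ring.
Qed.

Lemma vix_integral (P : R -> R) w I :
  has_Rintegral (@strikes R) (fun K => (2 * xi + 4 * xi ^+ 2 * K ^+ 2) *
     expR (xi * K ^+ 2) * P K) I ->
  has_Rintegral (@strikes R) (fun K => vix_density w K * P K) (- 1 * I).
Proof.
move=> hI; have mS := @measurable_strikes R.
apply: eq_has_Rintegral (has_RintegralZl (- 1) mS hI) => // K K0 /=.
by rewrite /vix_density; ring.
Qed.

Lemma zero_integral (f P : R -> R) : (forall K, f K = 0) ->
  has_Rintegral (@strikes R) (fun K => f K * P K) 0.
Proof.
move=> f0; apply: has_Rintegral0; first exact: measurable_strikes.
by move=> K _; rewrite f0 mul0r.
Qed.

(** * Values of the strips at T and at T + tau *)

Lemma has_Rintegral_vix_puts w :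
  has_Rintegral (@strikes R)
    (fun K => if K < F w then put M T K T' w / K ^+ 2 else 0)
    (\int[mu]_(K in vix_put_strikes M w) vix_put_integrand M w K).
Proof.
have mS := @measurable_strikes R.
have vE : vix_put_strikes M w = [set` `]0, F w[].
  by apply/seteqP; split=> K; rewrite /vix_put_strikes /= in_itv.
apply: (has_Rintegral_subset (D' := vix_put_strikes M w)
  (g := vix_put_integrand M w)) => //.
- by rewrite vE.
- by move=> K /andP[].
- by move=> K /andP[_ ->].
- by move=> K K0 /negP; rewrite K0/= => /negbTE ->.
- by split=> //; exact: (vix_put_finite hM).
Qed.

Lemma has_Rintegral_vix_calls w :
  has_Rintegral (@strikes R)
    (fun K => if F w < K then call M T K T' w / K ^+ 2 else 0)
    (\int[mu]_(K in vix_call_strikes M w) vix_call_integrand M w K).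
Proof.
have mS := @measurable_strikes R.
have vE : vix_call_strikes M w = [set` `]F w, +oo[].
  by apply/seteqP; split=> K; rewrite /vix_call_strikes /= in_itv/= andbT.
apply: (has_Rintegral_subset (D' := vix_call_strikes M w)
  (g := vix_call_integrand M w)) => //.
- by rewrite vE.
- by move=> K; apply: lt_trans; exact: futures_gt0.
- by move=> K /= ->.
- by move=> K K0 /negP/negbTE ->.
- by split=> //; exact: (vix_call_finite hM).
Qed.

Lemma bondTT (u : R) : bond M u u = 1.
Proof. by rewrite /bond subrr mulr0 oppr0 expR0. Qed.

Lemma spot_futures w : spot M T w = F w * B.
Proof. by rewrite /futures divfK// gt_eqF// expR_gt0. Qed.

Lemma xit_gt0 : 0 < X.
Proof. by rewrite divr_gt0 ?mulr_gt0// (tau_gt0 hM). Qed.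

Lemma hedge_leg_cost w u I J1 J2 :
  has_Rintegral (@strikes R) (fun K => put M u K T' w / K `^ (X * q + 2)) I ->
  has_Rintegral (@strikes R)
    (fun K => if K < F w then put M u K T' w / K ^+ 2 else 0) J1 ->
  has_Rintegral (@strikes R)
    (fun K => if F w < K then call M u K T' w / K ^+ 2 else 0) J2 ->
  leg_cost M u T' hedge_leg w =
  loan w * (q * xi * L w - 1) * bond M u T' + put_coef * I -
  log_position w * (J1 + J2).
Proof.
move=> hI hJ1 hJ2; rewrite /leg_cost.
have [_ ->] := hedge_put_integral hI hJ1.
have [_ ->] := hedge_call_integral hJ2.
by rewrite /=; ring.
Qed.

Lemma has_Rintegral_put_maturity w :
  has_Rintegral (@strikes R) (fun K => put M T' K T' w / K `^ (X * q + 2))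
    (spot M T' w `^ (- (X * q)) / (X * q * (X * q + 1))).
Proof.
have T'0 : 0 <= T' by rewrite (le_trans (ltW (mat_gt0 hM)))// mat_le_mat_tau.
have Xq0 : 0 < X * q by rewrite mulr_gt0 ?xit_gt0// (lt_trans ltr01).
apply: eq_has_Rintegral (has_Rintegral_put_power Xq0 (spot_gt0 hM w T'0)).
  exact: measurable_strikes.
by move=> K K0; rewrite (put_payoff hM).
Qed.

Lemma has_Rintegral_put_log_maturity w :
  has_Rintegral (@strikes R)
    (fun K => if K < F w then put M T' K T' w / K ^+ 2 else 0)
    (if spot M T' w < F w then
       (spot M T' w - F w) / F w - ln (spot M T' w / F w) else 0).
Proof.
have T'0 : 0 <= T' by rewrite (le_trans (ltW (mat_gt0 hM)))// mat_le_mat_tau.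
apply: eq_has_Rintegral
  (has_Rintegral_put_log (spot_gt0 hM w T'0) (futures_gt0 w)).
  exact: measurable_strikes.
by move=> K K0; rewrite (put_payoff hM).
Qed.

Lemma has_Rintegral_call_log_maturity w :
  has_Rintegral (@strikes R)
    (fun K => if F w < K then call M T' K T' w / K ^+ 2 else 0)
    (if F w < spot M T' w then
       (spot M T' w - F w) / F w - ln (spot M T' w / F w) else 0).
Proof.
have T'0 : 0 <= T' by rewrite (le_trans (ltW (mat_gt0 hM)))// mat_le_mat_tau.
apply: eq_has_Rintegral
  (has_Rintegral_call_log (spot_gt0 hM w T'0) (futures_gt0 w)).
  exact: measurable_strikes.
by move=> K K0; rewrite (call_payoff hM).
Qed.

Lemma has_Rintegral_call_maturity w :
  has_Rintegral (@strikes R) (fun K => call M T K T w / K `^ (2 - X * p))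
    (spot M T w `^ (X * p) / (X * p * (X * p - 1))).
Proof.
have T0 : 0 <= T by exact: ltW (mat_gt0 hM).
apply: eq_has_Rintegral (has_Rintegral_call_power hxip (spot_gt0 hM w T0)).
  exact: measurable_strikes.
by move=> K K0; rewrite (call_payoff hM).
Qed.

Lemma has_Rintegral_vixcall_maturity w :
  has_Rintegral (@strikes R) (fun K => (2 * xi + 4 * xi ^+ 2 * K ^+ 2) *
     expR (xi * K ^+ 2) * vixcall M T K w) (expR (xi * L w) - 1).
Proof.
(* [Num.sqrt] is 0 on negative numbers, so the sign of L matters here. *)
have -> : L w = vix M w ^+ 2 by rewrite sqr_sqrtr// (vix_sq_ge0 hM).
apply: eq_has_Rintegral (has_Rintegral_call_expR_sq xi (sqrtr_ge0 (L w))).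
  exact: measurable_strikes.
by move=> K K0; rewrite (vixcall_payoff hM).
Qed.

(** * Cash flows and entry cost *)

Lemma hedge_leg_cost_mat w :
  has_Rintegral (@strikes R) (Pi1_integrand M xi q T w)
    (\int[mu]_(K in @strikes R) Pi1_integrand M xi q T w K) ->
  leg_cost M T T' hedge_leg w = Pi1 M xi q T w - loan w * B.
Proof.
move=> hPi1.
rewrite (hedge_leg_cost hPi1 (has_Rintegral_vix_puts w)
  (has_Rintegral_vix_calls w)).
(* Since L is [2 / (tau * B)] times the listed cost of the two strips, the bonds [loan * q * xi * L]
   cost exactly what the sale of the strips brings in. *)
rewrite /Pi1 -/put_coef -/B /log_position /vix_sq -/B.
set I := \int[mu]_(K in strikes (R:=R)) _.
set J1 := \int[mu]_(K in vix_put_strikes M w) _.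
set J2 := \int[mu]_(K in vix_call_strikes M w) _.
have B0 : B != 0 by rewrite gt_eqF ?expR_gt0.
have t0 : tau M != 0 by rewrite gt_eqF// (tau_gt0 hM).
by rewrite /put_coef /xit; field; rewrite B0.
Qed.

(** The face value was chosen so that the amount borrowed is the [q]-term of Young's inequality. *)
Lemma loan_mul_bond w :
  loan w * B = (F w `^ (- X) * expR (xi * L w)) `^ q / q.
Proof.
have B0 : B != 0 by rewrite gt_eqF ?expR_gt0.
have q0 : q != 0 by rewrite gt_eqF// (lt_trans ltr01).
rewrite powRM ?powR_ge0 ?expR_ge0// -powRrM mulNr -expRM /loan.
have -> : xi * L w * q = q * xi * L w by ring.
by field; rewrite q0.
Qed.

Lemma exp_vix_sq_le w : expR (xi * L w) <= F w `^ (X * p) / p + loan w * B.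
Proof.
have F0 := futures_gt0 w.
have FX : expR (xi * L w) = F w `^ X * (F w `^ (- X) * expR (xi * L w)).
  by rewrite mulrA powRN divff ?mul1r// gt_eqF// powR_gt0.
rewrite loan_mul_bond {1}FX powRrM; apply: conjugate_powR => //.
- exact: powR_ge0.
- by rewrite mulr_ge0 ?powR_ge0 ?expR_ge0.
- exact: lt_trans hp.
- exact: lt_trans hq.
Qed.

Lemma hedge_flow_T t w :
  has_Rintegral (@strikes R) (Pi1_integrand M xi q T w)
    (\int[mu]_(K in @strikes R) Pi1_integrand M xi q T w K) ->
  flow_T M t hedge w =
  F w `^ (X * p) / p + loan w * B - expR (xi * L w).
Proof.
move=> hPi1; rewrite /flow_T /= hedge_leg_cost_mat//.
rewrite /leg_value /leg_cost /vix_position_cost /=.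
have [_ ->] := near_call_integral w (has_Rintegral_call_maturity w).
have [_ ->] := far_put_integral w hPi1.
have [_ ->] := vix_integral w (has_Rintegral_vixcall_maturity w).
have [_ ->] := zero_integral (fun K => put M T K T w) (fun=> erefl).
have [_ ->] := zero_integral (fun K => call M T K T' w) (fun=> erefl).
have p0 : p != 0 by rewrite gt_eqF// (lt_trans ltr01).
have X0 : X != 0 by rewrite gt_eqF// xit_gt0.
have Xp1 : X * p - 1 != 0 by rewrite gt_eqF// subr_gt0.
have B0 : 0 < B by exact: expR_gt0.
have BXp : B `^ (X * p) != 0 by rewrite gt_eqF// powR_gt0.
(* Writing [S_T = F * B] cancels the power of [B] in [call_coef], and the short bond absorbs the
   [- 1] in the payoff of the VIX calls. *)
rewrite bondTT spot_futures powRM ?ltW ?(futures_gt0)// /Pi1 -/put_coef.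
rewrite -/B /call_coef.
by field; rewrite p0 X0 Xp1 BXp.
Qed.

Lemma hedge_flow_end_ge0 w : 0 <= flow_end M hedge w.
Proof.
have T'0 : 0 <= T' by rewrite (le_trans (ltW (mat_gt0 hM)))// mat_le_mat_tau.
have S0 := spot_gt0 hM w T'0.
have F0 := futures_gt0 w.
rewrite /flow_end /= /leg_value (hedge_leg_cost (has_Rintegral_put_maturity w)
  (has_Rintegral_put_log_maturity w) (has_Rintegral_call_log_maturity w)).
(* The futures thus gain [S - F], which offsets the linear term of the strips and leaves the
   logarithm. *)
have -> : futures M T' T' w = spot M T' w by rewrite /futures bondTT divr1.
rewrite put_call_log_payoff// bondTT /= powR_inv1 ?(ltW F0)//.
have B0 : 0 < B by exact: expR_gt0.
have q0 : 0 < q by exact: lt_trans hq.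
(* In logarithmic variables the debt is [e^y / (qB)] and the puts pay [e^z / (qB)]; the final flow
   is the gap at [z] between the exponential and its tangent at [y], divided by [qB]. *)
pose y := - (X * q) * ln (F w) + q * xi * L w.
pose z := - (X * q) * ln (spot M T' w).
have loanE : loan w = expR y / (q * B).
  by rewrite /loan /powR (gt_eqF F0) expRD.
have SE : spot M T' w `^ (- (X * q)) = expR z by rewrite /powR (gt_eqF S0).
have X0 := xit_gt0.
have Xq1 : 0 < X * q + 1 by rewrite addr_gt0// mulr_gt0.
rewrite SE /put_coef /log_position loanE ln_div ?posrE//.
rewrite [leRHS](_ : _ = (expR z - expR y * (1 + (z - y))) / (q * B));
  last first.
  by rewrite /z /y; field; rewrite !gt_eqF.
apply: divr_ge0; last by rewrite mulr_ge0 ?ltW.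
rewrite subr_ge0.
have -> : expR z = expR y * expR (z - y) by rewrite -expRD addrCA subrr addr0.
by rewrite ler_pM2l ?expR_gt0// expR_ge1Dx.
Qed.

Lemma hedge_entry_cost t w :
  has_Rintegral (@strikes R) (Pi1_integrand M xi q t w)
    (\int[mu]_(K in @strikes R) Pi1_integrand M xi q t w K) ->
  has_Rintegral (@strikes R) (Pi2_integrand M xi p t w)
    (\int[mu]_(K in @strikes R) Pi2_integrand M xi p t w K) ->
  has_Rintegral (@strikes R) (Pi3_integrand M xi t w)
    (\int[mu]_(K in @strikes R) Pi3_integrand M xi t w K) ->
  entry_cost M t hedge w = Pi1 M xi q t w + Pi2 M xi p t w - Pi3 M xi t w.
Proof.
move=> h1 h2 h3; rewrite /entry_cost /leg_cost /vix_position_cost /=.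
have [_ ->] := near_call_integral w h2.
have [_ ->] := far_put_integral w h1.
have [_ ->] := vix_integral w h3.
have [_ ->] := zero_integral (fun K => put M t K T w) (fun=> erefl).
have [_ ->] := zero_integral (fun K => call M t K T' w) (fun=> erefl).
by rewrite /Pi1 /Pi2 /Pi3 -/put_coef -/call_coef; ring.
Qed.

(** * Measurability of the positions and admissibility *)

Lemma known_cst (u c : R) : known_at M u (fun=> c).
Proof. exact: measurable_cst. Qed.

Lemma known_curve_cst (u c : R) : known_curve_at M u (fun _ _ => c).
Proof. exact: measurable_cst. Qed.

Lemma known_curve_powR (u k c : R) : known_curve_at M u (fun _ K => k * K `^ c).
Proof.
by apply: measurable_funM; [exact: measurable_cst|exact: measurable_curve_powR].
Qed.

Lemma near_leg_known u : leg_known_at M u near_leg.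
Proof.
split; [exact: known_cst|exact: known_cst|exact: known_curve_cst|].
exact: known_curve_powR.
Qed.

Lemma far_leg_known u : leg_known_at M u far_leg.
Proof.
split; [exact: known_cst|exact: known_cst| |exact: known_curve_cst].
exact: known_curve_powR.
Qed.

Lemma vix_density_known u : known_curve_at M u vix_density.
Proof.
have mK : measurable_fun [set: g_sigma_algebraType (info M u) * R]
  (fun x => x.2 ^+ 2) by apply: measurable_funX; exact: measurable_snd.
apply: measurable_funTS; apply: measurable_funM => //; apply: measurable_funM.
  by apply: measurable_funD => //; apply: measurable_funM.
by apply: measurableT_comp => //; apply: measurable_funM.
Qed.

Lemma loan_known : known_at M T loan.
Proof.
apply: measurable_funM => //; apply: measurable_funM.
  exact: (measurableT_comp (measurable_powR _) futures_known).
apply: measurableT_comp => //; apply: measurable_funM => //.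
exact: vix_sq_known.
Qed.

Lemma log_position_known : known_at M T log_position.
Proof.
apply: measurable_funM => //; apply: measurable_funM => //.
exact: loan_known.
Qed.

Lemma known_fst (f : Omega -> R) :
  known_at M T f -> measurable_fun setT (fun x : GT * R => f x.1).
Proof. by move=> mf; exact: (measurableT_comp mf measurable_fst). Qed.

Lemma hedge_leg_known : leg_known_at M T hedge_leg.
Proof.
have mF := known_fst futures_known; have ml := known_fst log_position_known.
have m2 : measurable_fun [set: GT * R] (fun x => x.2) by exact: measurable_snd.
split.
- apply: measurable_funM; first exact: loan_known.
  apply: measurable_funB => //; apply: measurable_funM => //.
  exact: vix_sq_known.
- apply: measurable_funM; first exact: log_position_known.
  exact: (measurableT_comp (measurable_powR _) futures_known).
- apply: measurable_funTS; apply: measurable_funB.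
    by apply: measurable_funM => //; exact: measurable_curve_powR.
  apply: measurable_fun_ifT => //; first exact: measurable_fun_ltr.
  by apply: measurable_funM => //; exact: measurable_curve_powR.
- apply: measurable_funTS; apply: measurable_fun_ifT => //.
    exact: measurable_fun_ltr.
  apply: measurable_funM; first exact: measurableT_comp ml.
  exact: measurable_curve_powR.
Qed.

Lemma hedge_admissible t : 0 <= t -> t < T ->
  finite_portfolios M xi p q t -> finite_portfolios M xi p q T ->
  admissible M t hedge.
Proof.
move=> t0 tT fint finT.
have fin u w : u = t \/ u = T ->
    [/\ finite_integral (@strikes R) (Pi1_integrand M xi q u w),
      finite_integral (@strikes R) (Pi2_integrand M xi p u w) &
      finite_integral (@strikes R) (Pi3_integrand M xi u w)].
  by case=> ->; [exact: fint|exact: finT].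
split.
- split; [exact: known_cst|exact: near_leg_known|exact: far_leg_known|].
  exact: vix_density_known.
- by split; [exact: known_cst|exact: hedge_leg_known].
- move=> u utT; split=> w; have [i1 i2 i3] := fin u w utT.
  + split.
      by have [] := zero_integral (fun K => put M u K T w) (fun=> erefl).
    by have [] := near_call_integral w (conj i2 erefl).
  + split; first by have [] := far_put_integral w (conj i1 erefl).
    by have [] := zero_integral (fun K => call M u K T' w) (fun=> erefl).
  + by have [] := vix_integral w (conj i3 erefl).
(* For the second period, finiteness at T comes from Pi^1 and the VIX strips, and at T + tau from
   the explicit payoffs. *)
- move=> u [->|->] w.
    have [i1 _ _] := finT w; split.
      by have [] := hedge_put_integral (conj i1 erefl) (has_Rintegral_vix_puts w).
    by have [] := hedge_call_integral (has_Rintegral_vix_calls w).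
  split.
    by have [] := hedge_put_integral (has_Rintegral_put_maturity w)
      (has_Rintegral_put_log_maturity w).
  by have [] := hedge_call_integral (has_Rintegral_call_log_maturity w).
Qed.

End strategy.

(** * The arbitrage on the event [A] *)

Theorem proposition3p6 (R : realType) (d : measure_display)
    (Omega : measurableType d) (P : probability Omega R)
    (M : market Omega R) (hM : is_market M)
    (xi p q : R) (hxi : 0 < xi) (hp : 1 < p) (hq : 1 < q)
    (hpq : p^-1 + q^-1 = 1) (hxip : 1 < xit M xi * p)
    (t : R) (ht0 : 0 <= t) (htT : t < mat M)
    (hfint : finite_portfolios M xi p q t)
    (hfinT : finite_portfolios M xi p q (mat M))
    (A : set Omega) (hA : info M t A) (hPA : (0 < P A)%E)
    (hrev : forall w, A w ->
       Pi1 M xi q t w + Pi2 M xi p t w < Pi3 M xi t w) :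
  arbitrage M P t A.
Proof.
have cost_lt0 w : A w -> entry_cost M t (hedge M xi p q) w < 0.
  move=> Aw; have [i1 i2 i3] := hfint w.
  by rewrite (hedge_entry_cost (conj i1 erefl) (conj i2 erefl) (conj i3 erefl))
    subr_lt0 hrev.
exists (hedge M xi p q); split.
- exact: hedge_admissible.
- by move=> w /cost_lt0/ltW.
- move=> w _; split; last exact: hedge_flow_end_ge0.
  have [i1 _ _] := hfinT w.
  by rewrite (hedge_flow_T hM hxi hp hxip _ (conj i1 erefl)) subr_ge0
    exp_vix_sq_le.
(* The profit is locked in at the outset: the entry cost is negative throughout [A]. *)
- by left.
Qed.
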